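(* Let $N\ge 1$ and let $\mathtt{X}_N=(X_1,\dots,X_N)$ be an exchangeable vector of $\{0,1\}$-valued random variables. Let $\gamma=\sum_{i=1}^N X_i$, and assume $P(\gamma=i-1)\,P(\gamma=i+1)>0$ for all $1\le i\le N-1$. (a) If $\gamma$ is 2nd-order tighter than the Binomial, then belief in maturity holds for $\mathtt{X}_N$. (b) If $\gamma$ is 2nd-order looser than the Binomial, then belief in reverse maturity holds for $\mathtt{X}_N$.
   Context: Exchangeable: $P(X_1=x_1,\dots,X_N=x_N)=P(X_1=x_{\psi(1)},\dots,X_N=x_{\psi(N)})$ for every permutation $\psi$ of $\{1,\dots,N\}$ and every $(x_1,\dots,x_N)\in\{0,1\}^N$. Belief in maturity: $P(X_{n+1}=1\mid X_1=0,\dots,X_n=0)$ is strictly increasing in $n\in\{0,1,\dots,N-1\}$ (for $n=0$ this is $P(X_1=1)$). Belief in reverse maturity: $P(X_{n+1}=1\mid X_1=0,\dots,X_n=0)$ is strictly decreasing in $n\in\{0,1,\dots,N-1\}$. A random variable $\gamma\in\{0,1,\dots,N\}$ is 2nd-order tighter than the Binomial if $$\frac{P(\gamma=i)^2}{P(\gamma=i+1)P(\gamma=i-1)}>\frac{(i+1)(N-i+1)}{i(N-i)}\quad\text{for all }1\le i\le N-1,$$ and 2nd-order looser than the Binomial if $$\frac{P(\gamma=i)^2}{P(\gamma=i+1)P(\gamma=i-1)}<\frac{(i+1)(N-i+1)}{i(N-i)}\quad\text{for all }1\le i\le N-1.$$ *)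

(* Defs.v *)
From HB Require Import structures.
From mathcomp Require Import all_boot all_order all_algebra all_fingroup.
From mathcomp Require Import all_classical all_reals all_analysis.
From mathcomp Require Import measurable_realfun.
Set Implicit Arguments.
Unset Strict Implicit.
Unset Printing Implicit Defensive.
Import Order.TTheory GRing.Theory Num.Theory.
Local Open Scope classical_set_scope.
Local Open Scope ring_scope.

(* {0,1}-valued variables are random variables in bool (true is 1, false is 0,
   as in the coercion nat_of_bool), whose sigma-algebra is discrete.
   The vector (X_1, ..., X_N) is indexed from 0: X i stands for X_{i+1}. *)

Definition exchangeable d (T : measurableType d) (R : realType)
    (P : probability T R) (N : nat) (X : 'I_N -> {RV P >-> bool}) : Prop :=
  forall (psi : 'S_N) (x : 'I_N -> bool),
    P [set t | forall i, X i t = x i] = P [set t | forall i, X i t = x (psi i)].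

(* Equal to 0 when P B = 0. *)
Definition cond_prob d (T : measurableType d) (R : realType)
    (P : probability T R) (A B : set T) : R :=
  fine (P (A `&` B)) / fine (P B).

(* P(X_{n+1} = 1 | X_1 = 0, ..., X_n = 0); for n = 0 the conditioning event is
   setT. *)
Definition prob_one_after_zeros d (T : measurableType d) (R : realType)
    (P : probability T R) (N : nat) (X : 'I_N -> {RV P >-> bool})
    (n : 'I_N) : R :=
  cond_prob P [set t | X n t = true]
              [set t | forall i : 'I_N, (i < n)%N -> X i t = false].

Definition belief_in_maturity d (T : measurableType d) (R : realType)
    (P : probability T R) (N : nat) (X : 'I_N -> {RV P >-> bool}) : Prop :=
  forall m n : 'I_N, (m < n)%N ->
    prob_one_after_zeros X m < prob_one_after_zeros X n.

Definition belief_in_reverse_maturity d (T : measurableType d) (R : realType)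
    (P : probability T R) (N : nat) (X : 'I_N -> {RV P >-> bool}) : Prop :=
  forall m n : 'I_N, (m < n)%N ->
    prob_one_after_zeros X n < prob_one_after_zeros X m.

Definition num_ones d (T : measurableType d) (R : realType)
    (P : probability T R) (N : nat) (X : 'I_N -> {RV P >-> bool}) (t : T) :
  nat := (\sum_(i < N) X i t)%N.

Lemma measurable_num_ones d (T : measurableType d) (R : realType)
    (P : probability T R) (N : nat) (X : 'I_N -> {RV P >-> bool}) :
  measurable_fun [set: T] (num_ones X).
Proof.
rewrite /num_ones; elim: (index_enum _) => [|i s IHs].
  by under eq_fun do rewrite big_nil; exact: measurable_cst.
under eq_fun do rewrite big_cons; apply: measurable_fun_addn; last exact: IHs.
exact: (measurableT_comp (f := nat_of_bool)).
Qed.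

HB.instance Definition _ d (T : measurableType d) (R : realType)
    (P : probability T R) (N : nat) (X : 'I_N -> {RV P >-> bool}) :=
  isMeasurableFun.Build _ _ _ _ (num_ones X) (measurable_num_ones X).

(* The library's pmf is restricted to real-valued random variables. *)
Definition nat_pmf d (T : measurableType d) (R : realType)
    (P : probability T R) (g : {RV P >-> nat}) (i : nat) : R :=
  fine (P (g @^-1` [set i])).
Arguments nat_pmf {d T R} P g i.

(* The comparison law is Binomial(N, p), 0 < p < 1; its ratio does not depend on p. *)
Definition second_order_tighter d (T : measurableType d) (R : realType)
    (P : probability T R) (N : nat) (g : {RV P >-> nat}) : Prop :=
  forall i : nat, (1 <= i <= N - 1)%N ->
    nat_pmf P g i ^+ 2 / (nat_pmf P g (i + 1) * nat_pmf P g (i - 1)) >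
      ((i + 1) * (N - i + 1))%:R / (i * (N - i))%:R.

Definition second_order_looser d (T : measurableType d) (R : realType)
    (P : probability T R) (N : nat) (g : {RV P >-> nat}) : Prop :=
  forall i : nat, (1 <= i <= N - 1)%N ->
    nat_pmf P g i ^+ 2 / (nat_pmf P g (i + 1) * nat_pmf P g (i - 1)) <
      ((i + 1) * (N - i + 1))%:R / (i * (N - i))%:R.

Arguments second_order_tighter {d T R} P N g.
Arguments second_order_looser {d T R} P N g.

(* Main.v *)
(** Write [q j = P(gamma = j) / C(N, j)], the probability of any single outcome
    with [j] ones.  The comparison with the binomial says that
    [q (j+1)^2 - q j * q (j+2)] has a constant sign (Turan).  By exchangeability,
    the probability that [N - m] given coordinates take given values, [j] of them
    being 1, is the [m]-th iterate of the Pascal operator [q j + q (j+1)],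
    because one can split on the value of one more coordinate.  The Pascal
    operator preserves the sign of the Turan expressions, and this sign is that
    of the difference of two consecutive conditional probabilities. *)
Require Import Defs.
From mathcomp Require Import all_boot all_order all_algebra all_fingroup.
From mathcomp Require Import all_classical all_reals all_analysis.
From mathcomp Require Import ring lra zify.
Import Order.TTheory GRing.Theory Num.Theory.
Local Open Scope classical_set_scope.
Local Open Scope ring_scope.

(** * The Pascal operator and Turan expressions *)

Definition pascal {R : nmodType} (q : nat -> R) (j : nat) : R := q j + q j.+1.

(** Mirrors the positivity assumption on [gamma]. For [N >= 3] it makes every [q j] with [j <= N]
    positive, but for [N = 2] the middle value [q 1] may vanish. *)
Definition pos_two_apart {R : realFieldType} (N : nat) (q : nat -> R) : Prop :=
  forall j, (j.+2 <= N)%N -> 0 < q j /\ 0 < q j.+2.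

(** The factor [s], later [1] or [-1], treats the tighter and the looser case at once. *)
Definition turan_sign {R : realFieldType} (s : R) (N : nat) (q : nat -> R) :
    Prop :=
  forall j, (j.+2 <= N)%N -> 0 < s * (q j.+1 ^+ 2 - q j * q j.+2).

Lemma pascal_iter_ge0 (R : realFieldType) (q : nat -> R) :
  (forall j, 0 <= q j) -> forall m j, 0 <= iter m pascal q j.
Proof. by move=> q0; elim=> //= m IH j; rewrite /pascal addr_ge0. Qed.

Lemma pascal_pos_two_apart {R : realFieldType} (N : nat) (q : nat -> R) :
  pos_two_apart N.+1 q -> pos_two_apart N (pascal q).
Proof.
move=> q0 j jN; have [a c] := q0 j (leqW jN).
by have [b d] := q0 j.+1 jN; rewrite /pascal !addr_gt0.
Qed.

(** For consecutive values [a, b, c, d], the new Turan expression is the sum of the two old ones and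
    the cross term [b c - a d]. Multiplied by [b > 0], the cross term is a combination of the old
    expressions with positive coefficients [c] and [a]. *)
Lemma pascal_turan_sign (R : realFieldType) (s : R) (N : nat) (q : nat -> R) :
  pos_two_apart N.+1 q -> turan_sign s N.+1 q -> turan_sign s N (pascal q).
Proof.
move=> q0 qs j jN; rewrite /pascal.
have [a0 c0] := q0 j (leqW jN); have [b0 d0] := q0 j.+1 jN.
have := qs j (leqW jN); have := qs j.+1 jN.
move: (q j) (q j.+1) (q j.+2) (q j.+3) a0 b0 c0 d0 => a b c d a0 b0 c0 d0 v0 u0.
have w0 : 0 < s * (b * c - a * d).
  rewrite -(pmulr_rgt0 _ b0).
  have -> : b * (s * (b * c - a * d)) =
      c * (s * (b ^+ 2 - a * c)) + a * (s * (c ^+ 2 - b * d)) by ring.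
  by apply: addr_gt0; apply: mulr_gt0.
have -> : s * ((b + c) ^+ 2 - (a + b) * (c + d)) =
  s * (b ^+ 2 - a * c) + s * (c ^+ 2 - b * d) + s * (b * c - a * d) by ring.
by rewrite !addr_gt0.
Qed.

Lemma pascal_iter_turan_sign (R : realFieldType) (s : R) (m N : nat)
    (q : nat -> R) :
  pos_two_apart (m + N) q -> turan_sign s (m + N) q ->
  pos_two_apart N (iter m pascal q) /\
  turan_sign s N (iter m pascal q).
Proof.
elim: m N => [|m IH] N //=; rewrite addSnnS => q0 qs.
have [i0 is_] := IH N.+1 q0 qs.
by split; [exact: pascal_pos_two_apart|exact: pascal_turan_sign].
Qed.

Lemma pascal_ratio_sign (R : realFieldType) (s : R) (m N : nat) (q : nat -> R) :
  (m.+2 <= N)%N -> (forall j, 0 <= q j) ->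
  pos_two_apart N q -> turan_sign s N q ->
  0 < s * (iter m pascal q 1%N / iter m.+1 pascal q 0%N -
           iter m.+1 pascal q 1%N / iter m.+2 pascal q 0%N).
Proof.
move=> mN q0 qN sN.
have [] := pascal_iter_turan_sign R s m 2 q.
- by move=> j jm; apply: qN; rewrite (leq_trans jm)// addn2.
- by move=> j jm; apply: sN; rewrite (leq_trans jm)// addn2.
move=> /(_ 0%N isT)[a0 c0] /(_ 0%N isT); rewrite [iter m.+2 _ _]/= [iter m.+1 _ _]/=.
(* At length 2 only the outer values [a] and [c] are known to be positive. Together with [b >= 0]
   this makes both denominators positive, so the value of a division by 0 never enters. *)
have := pascal_iter_ge0 R q q0 m 1%N.
rewrite /pascal; move: (iter m _ _) a0 c0 => f.
move: (f 0%N) (f 1%N) (f 2%N) => a b c a0 c0 b0 u0.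
have ab : 0 < a + b by lra.
have abc : 0 < a + b + (b + c) by lra.
have -> : b / (a + b) - (b + c) / (a + b + (b + c)) =
   (b ^+ 2 - a * c) / ((a + b) * (a + b + (b + c))).
  by field; rewrite !gt_eqF.
by rewrite mulrA; apply: divr_gt0 => //; exact: mulr_gt0.
Qed.

(** The subtracted fraction is [C(N, j+1)^2 / (C(N, j) C(N, j+2))]. The recurrence [mul_bin_left],
    used at [j] and [j+1], expresses the outer binomial coefficients through the middle one. *)
Lemma turan_binomial_ratio (R : realFieldType) (N : nat) (p : nat -> R) (j : nat) :
  (j.+2 <= N)%N ->
  0 < p j * p j.+2 ->
  let q i := p i / 'C(N, i)%:R in
  q j.+1 ^+ 2 - q j * q j.+2 = p j * p j.+2 / 'C(N, j.+1)%:R ^+ 2 *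
   (p j.+1 ^+ 2 / (p j.+2 * p j) -
     (j.+2 * (N - j.+1 + 1))%:R / (j.+1 * (N - j.+1))%:R).
Proof.
move=> jN p0 q; rewrite /q.
have /(congr1 (GRing.natmul (1 : R))) := mul_bin_left N j.
have /(congr1 (GRing.natmul (1 : R))) := mul_bin_left N j.+1.
have C0 k : (k <= N)%N -> ('C(N, k)%:R : R) != 0 by rewrite pnatr_eq0 -lt0n bin_gt0.
have := C0 j; have := C0 j.+1; have := C0 j.+2.
have -> : (N - j.+1 + 1 = N - j)%N by lia.
rewrite !natrM.
have : ((N - j)%:R : R) != 0 by rewrite pnatr_eq0; lia.
have : ((N - j.+1)%:R : R) != 0 by rewrite pnatr_eq0; lia.
have : (j.+1%:R : R) != 0 by rewrite pnatr_eq0.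
have : (j.+2%:R : R) != 0 by rewrite pnatr_eq0.
move: (j.+1%:R) (j.+2%:R) ((N - j)%:R) ((N - j.+1)%:R) => a b c e b0 a0 e0 c0.
move: ('C(N, j)%:R) ('C(N, j.+1)%:R) ('C(N, j.+2)%:R) => u v w.
move=> /(_ jN) w0 /(_ (ltnW jN)) v0 /(_ (ltnW (ltnW jN))) u0 bw av.
have pj : p j != 0 by apply: contraTneq p0 => ->; rewrite mul0r ltxx.
have pj2 : p j.+2 != 0 by apply: contraTneq p0 => ->; rewrite mulr0 ltxx.
have -> : u = a * v / c by rewrite av mulrC mulKf.
have -> : w = e * v / b by rewrite -bw mulrC mulKf.
by field; rewrite pj pj2 v0 a0 b0 c0 e0.
Qed.

(** * Cylinder events of an exchangeable vector *)

Section Cylinder.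
Context {R : realType} {d : measure_display} {T : measurableType d}.
Context {P : probability T R} {N : nat} (X : 'I_N -> {RV P >-> bool}).

(** [U] holds the observed coordinates and [V] those equal to 1. When [V] lies in [U], [#|V|] is the
    number of ones prescribed. *)
Definition cylinder (U V : {set 'I_N}) : set T :=
  [set t | forall i, i \in U -> X i t = (i \in V)].

Lemma measurable_cylinder U V : measurable (cylinder U V).
Proof.
have -> : cylinder U V = \bigcap_(i in [set` U]) (X i @^-1` [set (i \in V)]).
  by apply/seteqP; split=> t /= h i /h.
apply: fin_bigcap_measurable => // i _.
by apply: measurable_funPTI.
Qed.

Lemma prob_cylinder_split (U V : {set 'I_N}) i : i \notin U -> V \subset U ->
  P (cylinder U V) = (P (cylinder (i |: U) V) + P (cylinder (i |: U) (i |: V)))%E.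
Proof.
move=> iU VU.
have iV : i \notin V by apply: contra iU => /(fintype.subsetP VU).
have mi : measurable (X i @^-1` [set true]) by exact: measurable_funPTI.
rewrite (measureDI P _ mi); last exact: measurable_cylinder.
congr (P _ + P _)%E; apply/seteqP; split=> t /=.
- move=> [h /negP/negPf hi] j; rewrite in_setU1 => /predU1P[->|/h//].
  by rewrite hi (negPf iV).
- move=> h; split=> [j jU|]; first by apply: h; rewrite in_setU1 jU orbT.
  by rewrite h ?setU11// (negPf iV).
- move=> [h hi] j; rewrite !in_setU1 => /predU1P[->|jU].
    by rewrite eqxx hi.
  by rewrite h//; case: eqVneq => [e|//]; rewrite -e jU in iU.
- move=> h; split=> [j jU|]; last by rewrite h ?setU11.
  rewrite h; last by rewrite in_setU1 jU orbT.
  by rewrite in_setU1; case: eqVneq => [e|//]; rewrite -e jU in iU.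
Qed.

Lemma prob_cylinderT_card (hX : exchangeable X) (V W : {set 'I_N}) : #|V| = #|W| ->
  P (cylinder finset.setT V) = P (cylinder finset.setT W).
Proof.
move=> VW.
pose v := [tuple i \in V | i < N]; pose w := [tuple i \in W | i < N].
have cnt (A : {set 'I_N}) : count_mem true [tuple i \in A | i < N] = #|A|.
  rewrite /= count_map cardE [in RHS]/enum_mem size_filter enumT.
  by apply: eq_count => i /=; rewrite eqb_id.
(* The indicator words of [V] and [W] have equally many [true] and equally many [false], so some
   permutation [s] turns one into the other. *)
have /tuple_permP[s sE] : perm_eq w v.
  apply/allP => -[] _ /=; apply/eqP; first by rewrite !cnt.
  have E (A : {set 'I_N}) : count_mem false [tuple i \in A | i < N] = (N - #|A|)%N.
    have := count_predC (pred1 true) [tuple i \in A | i < N].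
    rewrite size_tuple cnt => /(canRL (addKn _)) <-.
    by apply: eq_count => -[].
  by rewrite !E VW.
have {}sE i : (i \in W) = (s i \in V).
  have := congr1 (fun u => nth false u i) sE.
  by rewrite -!tnth_nth !tnth_mktuple.
have -> : cylinder finset.setT V = [set t | forall i, X i t = (i \in V)].
  by apply/seteqP; split=> t /= h i //; apply: h; rewrite inE.
rewrite (hX s); congr (P _); apply/seteqP; split=> t /= h i.
- by move=> _; rewrite h sE.
- by rewrite h ?inE// sE.
Qed.

(** The event [gamma = #|V|] is the disjoint union of [C(N, #|V|)] full cylinders, all equally
    likely by exchangeability. *)
Lemma prob_cylinderT (hX : exchangeable X) (V : {set 'I_N}) :
  fine (P (cylinder finset.setT V)) = nat_pmf P (num_ones X) #|V| / 'C(N, #|V|)%:R.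
Proof.
have C0 : ('C(N, #|V|)%:R : R) != 0.
  by rewrite pnatr_eq0 -lt0n bin_gt0 -[leqRHS]card_ord max_card.
apply: (mulIf C0); rewrite divfK// /nat_pmf.
have -> : num_ones X @^-1` [set #|V|] =
   \bigcup_(W in [set W : {set 'I_N} | #|W| == #|V|]) cylinder finset.setT W.
  have ones t : num_ones X t = #|[set i | X i t]%SET|.
    by rewrite -sum1_card big_mkcond; apply: eq_bigr => i _; rewrite inE; case: (X i t).
  apply/seteqP; split=> t /=; rewrite ones.
    by move=> h; exists [set i | X i t]%SET => /=; [exact/eqP|move=> i _; rewrite inE].
  move=> [W /eqP <- h]; congr #|pred_of_set _|; apply/setP => i.
  by rewrite inE h ?inE.
rewrite measure_fin_bigcup//.
- have -> : [set W : {set 'I_N} | #|W| == #|V|] =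
      [set` [pred W : {set 'I_N} | #|W| == #|V|]] by [].
  rewrite -(@bigfs _ _ _ _ (index_enum _)) ?index_enum_uniq//; last first.
    by move=> W _; rewrite mem_index_enum.
  rewrite (eq_bigr (fun=> P (cylinder finset.setT V))); last first.
    by move=> W /eqP; exact: prob_cylinderT_card.
  have fP := fin_num_measure P _ (measurable_cylinder finset.setT V).
  rewrite -sum_fine// sumr_const mulr_natr; congr (_ *+ _).
  by have := card_draws 'I_N #|V|; rewrite card_ord cardsE => ->.
- exact: finite_finset.
- move=> W W' _ _ [t [/= h h']]; apply/setP => i.
  by rewrite -h ?inE// h'.
- by move=> W _; exact: measurable_cylinder.
Qed.

Lemma prob_cylinder (hX : exchangeable X) (U V : {set 'I_N}) : V \subset U ->
  fine (P (cylinder U V)) =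
  iter #|~: U| pascal (fun i => nat_pmf P (num_ones X) i / 'C(N, i)%:R) #|V|.
Proof.
have [m] := ubnP #|~: U|; elim: m U V => // m IH U V Um VU.
have [|] := boolP (~: U == finset.set0).
  rewrite -finset.setCT => /eqP/finset.setC_inj ->.
  by rewrite finset.setCT cards0/= prob_cylinderT.
case/set0Pn => i; rewrite inE => iU.
have cU : #|~: U| = #|~: (i |: U)|.+1.
  by rewrite (cardsD1 i) inE iU; congr (_.+1); apply: eq_card => k; rewrite !inE negb_or.
have iV : i \notin V by apply: contra iU => /(fintype.subsetP VU).
(* Fixing [i] to 0 or 1 leaves one free coordinate fewer and [#|V|] or [#|V| + 1] ones: one Pascal
   step. *)
rewrite (prob_cylinder_split _ _ _ iU VU) fineD ?fin_num_measure//; try exact: measurable_cylinder.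
rewrite cU ltnS in Um.
rewrite !IH ?(leq_trans Um)//; [|by rewrite finset.setUS|by rewrite (fintype.subset_trans VU)// finset.subsetUr].
by rewrite cU /= /pascal cardsU1 iV.
Qed.

Lemma prob_one_after_zerosE (hX : exchangeable X) (n : 'I_N) :
  let S m := iter m pascal (fun i => nat_pmf P (num_ones X) i / 'C(N, i)%:R) in
  prob_one_after_zeros X n = S (N - n.+1)%N 1%N / S (N - n)%N 0%N.
Proof.
move=> S; rewrite /prob_one_after_zeros /cond_prob.
pose U := [set i : 'I_N | (i < n)%N]%SET.
have cU : #|U| = n.
  rewrite -sum1_card (eq_bigl (fun i : 'I_N => (i < n)%N)); last by move=> i; rewrite inE.
  by rewrite -(big_ord_widen N (fun=> 1%N) (ltnW (ltn_ord n))) sum1_card card_ord.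
have nU : n \notin U by rewrite inE ltnn.
have -> : [set t | forall i : 'I_N, (i < n)%N -> X i t = false] = cylinder U finset.set0.
  by apply/seteqP; split=> t /= h i; move: (h i); rewrite !inE.
(* Indices start at 0, so coordinate [n] comes right after the [n] observed zeros; the intersection
   fixes [n + 1] coordinates, exactly one of them to 1. *)
have -> : [set t | X n t = true] `&` cylinder U finset.set0 = cylinder (n |: U) [set n].
  apply/seteqP; split=> t /=.
    move=> [hn h] i; rewrite !inE => /predU1P[->|iU]; first by rewrite eqxx.
    by rewrite h ?inE//; case: eqP iU => // ->; rewrite ltnn.
  move=> h; split; first by rewrite h ?setU11// inE eqxx.
  move=> i iU; rewrite h; last by rewrite in_setU1 iU orbT.
  by rewrite !inE; case: eqVneq iU => // ->; rewrite (negPf nU).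
rewrite !prob_cylinder ?finset.sub0set ?finset.subsetUl// cards0 cards1.
have cC (A : {set 'I_N}) : #|~: A| = (N - #|A|)%N.
  by have := cardsC A; rewrite card_ord => /(canRL (addKn _)) ->.
by rewrite !cC cardsU1 nU cU.
Qed.

Lemma exchangeable_sign_monotone (hX : exchangeable X) (s : R) :
  let q i := nat_pmf P (num_ones X) i / 'C(N, i)%:R in
  pos_two_apart N q -> turan_sign s N q ->
  forall m n : 'I_N, (m < n)%N ->
  0 < s * (prob_one_after_zeros X n - prob_one_after_zeros X m).
Proof.
move=> q q0 qs m n mn; rewrite !prob_one_after_zerosE// -/q.
pose g k := iter (N - k.+1) pascal q 1%N / iter (N - k) pascal q 0%N.
rewrite -[X in s * (X - _)]/(g n) -[X in s * (_ - X)]/(g m).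
pose r (x y : R) := 0 < s * (y - x).
(* By transitivity of [r] it suffices to compare [g k] and [g k.+1]. *)
apply: (@homo_ltn_in _ [pred k | (k < N)%N] g r) => //; rewrite /r ?inE//.
- by move=> y x z xy yz; rewrite -(subrKA y) mulrDr addr_gt0.
- by move=> i j _ jN k /andP[_ kj]; exact: ltn_trans jN.
move=> k _; rewrite inE => kN; rewrite /g.
(* Since [k + 1 < N], these subtractions are not truncated, and the ratio lemma applies with
   [m = N - k - 2]. *)
have -> : (N - k.+1 = (N - k.+2).+1)%N by lia.
have -> : (N - k = (N - k.+2).+2)%N by lia.
apply: (pascal_ratio_sign _ _ _ N) => //; first by lia.
by move=> j; rewrite divr_ge0// fine_ge0.
Qed.

End Cylinder.

Theorem theorem2 (R : realType) (d : measure_display) (T : measurableType d)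
    (P : probability T R) (N : nat) (hN : (1 <= N)%N)
    (X : 'I_N -> {RV P >-> bool}) (hX : exchangeable X)
    (hpos : forall i : nat, (1 <= i <= N - 1)%N ->
       0 < nat_pmf P (num_ones X) (i - 1) * nat_pmf P (num_ones X) (i + 1)) :
  (second_order_tighter P N (num_ones X) -> belief_in_maturity X) /\
  (second_order_looser P N (num_ones X) -> belief_in_reverse_maturity X).
Proof.
pose p := nat_pmf P (num_ones X).
have p_ge0 i : 0 <= p i by rewrite fine_ge0.
have range j : (j.+2 <= N)%N -> (1 <= j.+1 <= N - 1)%N by lia.
have pp j : (j.+2 <= N)%N -> 0 < p j * p j.+2.
  by move=> /range/hpos; rewrite subn1 addn1.
have q0 : pos_two_apart N (fun i => p i / 'C(N, i)%:R).
  move=> j jN.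
  have C0 k : (k <= N)%N -> 0 < ('C(N, k)%:R : R) by rewrite ltr0n bin_gt0.
  have := pp j jN; have := p_ge0 j; have := p_ge0 j.+2.
  (* A positive product of nonnegative factors: neither factor is 0. *)
  rewrite !le_eqVlt => /predU1P[<-|pj2]; first by rewrite mulr0 ltxx.
  move=> /predU1P[<-|pj _]; first by rewrite mul0r ltxx.
  by split => /=; rewrite divr_gt0// C0// ltnW// ltnW.
(* The first case takes [s = 1], the second [s = -1]. *)
split=> h m n mn.
- rewrite -subr_gt0 -[_ - _]mul1r; apply: exchangeable_sign_monotone => //.
  move=> j jN; rewrite mul1r (turan_binomial_ratio _ _ _ _ jN)//; last exact: pp.
  apply: mulr_gt0; first by rewrite divr_gt0 ?pp// exprn_gt0// ltr0n bin_gt0 ltnW.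
  by rewrite subr_gt0; have := h _ (range j jN); rewrite !addn1 subn1.
- rewrite -subr_gt0 -opprB -mulN1r; apply: exchangeable_sign_monotone => //.
  move=> j jN; rewrite (turan_binomial_ratio _ _ _ _ jN)//; last exact: pp.
  rewrite mulN1r -mulrN opprB.
  apply: mulr_gt0; first by rewrite divr_gt0 ?pp// exprn_gt0// ltr0n bin_gt0 ltnW.
  by rewrite subr_gt0; have := h _ (range j jN); rewrite !addn1 subn1.
Qed.
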